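(* Let $1<p<\infty$ and $q=\max\{p,2\}$. There exists a constant $C<\infty$, depending only on $p$, such that for every integer $N\geq 1$ and every $1$-Lipschitz map from the binary rooted tree $T_N$ of depth $N$ to some $L^p$-space, the compression $\rho$ of this map satisfies $$\int_{1}^{2N}\left(\frac{\rho(t)}{t}\right)^q\frac{dt}{t}\leq C.$$
   Context: $T_N$ is the (vertex set of the) binary rooted tree of depth $N$, equipped with the tree distance $d$ (edges have length $1$). The compression of a map $F:X\to Y$ between metric spaces is $\rho(t)=\inf_{d_X(x,y)\geq t}d_Y(F(x),F(y))$. An $L^p$-space is a Banach space of the form $L^p(X,m)$ with $(X,m)$ a measure space. *)

(* Defs.v *)
From HB Require Import structures.
From mathcomp Require Import all_boot all_order all_algebra.
From mathcomp Require Import all_classical all_reals all_analysis.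

Set Implicit Arguments.
Unset Strict Implicit.
Unset Printing Implicit Defensive.

Import Order.TTheory GRing.Theory Num.Theory.
Import numFieldNormedType.Exports.

Local Open Scope classical_set_scope.
Local Open Scope ring_scope.

(* A vertex is the word of left/right choices leading to it from the root
   [::], so the depth of a vertex is the length of the word. *)
Notation tree N := (N.-bseq bool).

Definition tree_adj (N : nat) : rel (tree N) := fun u v =>
  [exists b : bool, (v == rcons u b :> seq bool) || (u == rcons v b :> seq bool)].

Definition tree_walk (N : nat) (u v : tree N) (n : nat) : bool :=
  [exists w : n.-tuple (tree N), path (@tree_adj N) u w && (last u w == v)].

Lemma tree_adj_sym N : symmetric (@tree_adj N).
Proof. by move=> u v; apply: eq_existsb => b; rewrite orbC. Qed.

Lemma tree_walk_ex N (u v : tree N) : exists n, tree_walk u v n.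
Proof.
suff /connectP[w uw vw] : connect (@tree_adj N) u v.
  exists (size w); apply/existsP; exists (in_tuple w).
  by rewrite /= uw -vw eqxx.
have root_to (x : tree N) : connect (@tree_adj N) (nil_bseq N bool) x.
  case: x; elim/last_ind => [|s b IHs] sN; first by apply: eq_connect0; exact: val_inj.
  have sN' : (size s <= N)%N by move: sN; rewrite size_rcons; exact: ltnW.
  apply: connect_trans (IHs sN') (connect1 _).
  by apply/existsP; exists b; rewrite /= eqxx.
apply: connect_trans (root_to v); rewrite (sym_connect_sym (@tree_adj_sym N)).
exact: root_to.
Qed.

Definition tree_dist (N : nat) (u v : tree N) : nat := ex_minn (tree_walk_ex u v).

(* The value is meaningful only for those t for which some pair of points is at
   distance at least t; otherwise it is the junk value inf set0 = 0 instead
   of +oo. *)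
Definition compression (R : realType) (X Y : Type) (dX : X -> X -> R)
    (dY : Y -> Y -> R) (F : X -> Y) (t : R) : R :=
  inf [set dY (F xy.1) (F xy.2) | xy in [set xy | t <= dX xy.1 xy.2]].

(* Elements of LspaceType are classes modulo almost everywhere equality; they
   are coerced here to representatives, whose choice does not affect the norm. *)
Definition Lp_dist (R : realType) (d : measure_display) (X : measurableType d)
    (m : {measure set X -> \bar R}) (p : \bar R) (p1 : (1 <= p)%E)
    (f g : LspaceType m p1) : R :=
  fine ('N[m]_p[EFin \o (fun x => f x - g x)]).

Lemma lt1_lee1 (R : realType) (p : R) : 1 < p -> (1 <= p%:E)%E.
Proof. by move=> /ltW; rewrite lee_fin. Qed.

(* Main.v *)
(* L^p is uniformly convex of power type q = max(p, 2).  Applied to y - x, z - y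
   and to y - x, w - y, this gives Lee-Naor-Peres' four point inequality
     |x-z|^q + |x-w|^q + c |z-w|^q
       <= 2^(q-1) (2 |x-y|^q + |y-z|^q + |y-w|^q).
   Take x = F(s), y = F(su), z = F(su0v), w = F(su1v) with |u| = 2^k, |v| = 2^k - 1;
   then |z-w| >= rho(2^(k+1)).  Averaging over u and v bounds the mean of
   |F(s) - F(st)|^q over words t of length 2^(k+1) by 2^q times the same mean for
   2^k, minus a multiple of rho(2^(k+1))^q.  As the means are nonnegative,
   the sum over k < K of (rho(2^(k+1)) / 2^k)^q, where 2^K <= N < 2^(K+1), is bounded
   independently of N, and since rho is nondecreasing it dominates the integral
   over [1, 2^K].  The two remaining dyadic intervals contribute O(1). *)
Require Import Defs.
From HB Require Import structures.
From mathcomp Require Import all_boot all_order all_algebra.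
From mathcomp Require Import all_classical all_reals all_analysis.
From mathcomp Require Import measurable_realfun ring lra.

Set Implicit Arguments.
Unset Strict Implicit.
Unset Printing Implicit Defensive.

Import Order.TTheory GRing.Theory Num.Theory.
Import numFieldNormedType.Exports.

Local Open Scope classical_set_scope.
Local Open Scope ring_scope.

(** * Elementary inequalities for real powers *)

Section powR_inequalities.
Context {R : realType}.
Implicit Types p r x y W : R.

Lemma powR2 x : 0 <= x -> x `^ 2 = x ^+ 2.
Proof. exact: powR_mulrn. Qed.

(** Each summand satisfies z^r = z z^(r-1) <= z (z+w)^(r-1). *)
Lemma powR_superadd r x y : 1 <= r -> 0 <= x -> 0 <= y ->
  x `^ r + y `^ r <= (x + y) `^ r.
Proof.
move=> r1 x0 y0; have r0 : 0 < r by exact: lt_le_trans r1.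
have le1 z w : 0 <= z -> 0 <= w -> z `^ r <= z * (z + w) `^ (r - 1).
  move=> z0 w0; rewrite -mulr_powRB1// ler_wpM2l// ge0_ler_powR ?subr_ge0//.
  - by rewrite nnegrE addr_ge0.
  - by rewrite lerDl.
rewrite -(@mulr_powRB1 _ (x + y))// ?addr_ge0// mulrDl lerD ?le1//.
by rewrite [in leRHS]addrC le1.
Qed.

(** Convexity of t^r at the midpoint of 2x and 2y. *)
Lemma powR_mean r x y : 1 <= r -> 0 <= x -> 0 <= y ->
  (x + y) `^ r <= 2 `^ (r - 1) * (x `^ r + y `^ r).
Proof.
move=> r1 x0 y0; have r0 : 0 < r by exact: lt_le_trans r1.
have h01 : 0 <= 2^-1 :> R by rewrite invr_ge0.
have h1 : 2^-1 <= 1 :> R by rewrite invf_le1// ler1n.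
have := @convex_powR R r r1 (Itv01 h01 h1) (2 * x) (2 * y).
rewrite !inE/= !in_itv/= !andbT !mulr_ge0// => /(_ isT isT).
rewrite convRE [X in X `^ _ <= _ -> _]convRE/=.
rewrite (_ : unstable.onem 2^-1 = 2^-1); last first.
  by rewrite /unstable.onem; lra.
rewrite !mulKf// !powRM// => /le_trans; apply.
rewrite -(@mulr_powRB1 _ 2 r)//.
by rewrite le_eqVlt; apply/orP; left; apply/eqP; field.
Qed.

(** With r = p/2 >= 1, superadditivity of t^r reduces the left side to the parallelogram identity,
    and convexity of t^r then separates x^2 from y^2. *)
Lemma clarkson_powR p x y : 2 <= p ->
  `|x + y| `^ p + `|x - y| `^ p <= 2 `^ (p - 1) * (`|x| `^ p + `|y| `^ p).
Proof.
move=> p2; pose r := p / 2; have r1 : 1 <= r by rewrite /r; lra.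
have sq z : `|z| `^ p = (z ^+ 2) `^ r.
  rewrite -normr_id -real_normK ?num_real// -powR2// -powRrM /r normr_id.
  by congr (_ `^ _); field.
rewrite !sq; apply: le_trans (powR_superadd r1 (sqr_ge0 _) (sqr_ge0 _)) _.
have -> : (x + y) ^+ 2 + (x - y) ^+ 2 = 2 * (x ^+ 2 + y ^+ 2) by ring.
rewrite powRM ?addr_ge0 ?sqr_ge0//.
have -> : 2 `^ (p - 1) = 2 `^ r * 2 `^ (r - 1).
  by rewrite -powRD ?pnatr_eq0 ?implybT//; congr (_ `^ _); rewrite /r; field.
by rewrite -mulrA ler_wpM2l ?powR_ge0// powR_mean ?sqr_ge0//.
Qed.

(** Mean value theorem for t^(p-1): since p - 2 <= 0, the factor c^(p-2) in the derivative at a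
    point c <= W is at least W^(p-2). *)
Lemma ler_powRB1 p x y W : 1 < p <= 2 -> 0 < x -> x <= y -> y <= W ->
  (p - 1) * W `^ (p - 2) * (y - x) <= y `^ (p - 1) - x `^ (p - 1).
Proof.
move=> /andP[p1 p2] x0; rewrite le_eqVlt => /predU1P[<-|xy] yW.
  by rewrite !subrr mulr0.
have dpow z : z \in `]x, y[ ->
    is_derive z 1 (@powR R ^~ (p - 1)) ((p - 1) * z `^ (p - 1 - 1)).
  rewrite in_itv/= => /andP[xz _].
  by apply: is_derive1_powR; exact: lt_trans xz.
have [|c /[!in_itv]/= /andP[xc cy] ->] := MVT xy dpow.
  apply: derivable_within_continuous => z /[!in_itv]/= /andP[xz _].
  by apply: derivable_powR; rewrite in_itv/= andbT; exact: lt_le_trans xz.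
apply: ler_wpM2r; first by rewrite subr_ge0 ltW.
apply: ler_wpM2l; first by rewrite subr_ge0 ltW.
have -> : p - 1 - 1 = - (2 - p) by ring.
have -> : p - 2 = - (2 - p) by ring.
have c0 : 0 < c by exact: lt_trans xc.
have W0 : 0 < W by apply: lt_le_trans yW; exact: lt_trans xy.
rewrite !powRN lef_pV2 ?posrE ?powR_gt0//.
by rewrite ge0_ler_powR ?subr_ge0 ?nnegrE ?(ltW c0) ?(ltW W0)// (le_trans (ltW cy)).
Qed.

Lemma ler_sqr_powR p x W : p <= 2 -> 0 <= x -> x <= W -> 0 < p ->
  W `^ (p - 2) * x ^+ 2 <= x `^ p.
Proof.
move=> p2 x0 xW p0; have [->|xn0] := eqVneq x 0.
  by rewrite expr0n/= mulr0 powR_ge0.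
have xgt0 : 0 < x by rewrite lt0r xn0.
have -> : x `^ p = x `^ (p - 2) * x ^+ 2.
  by rewrite -powR2// -powRD ?xn0 ?implybT// subrK.
rewrite ler_wpM2r ?sqr_ge0//; have -> : p - 2 = - (2 - p) by ring.
rewrite !powRN lef_pV2 ?posrE ?powR_gt0// ?(lt_le_trans xgt0)//.
by rewrite ge0_ler_powR ?subr_ge0 ?nnegrE// (le_trans x0).
Qed.

(* On [-W, W] the second derivative of |x|^p is at least p (p - 1) W^(p - 2). *)
Lemma powR_strong_tangent p x m W : 1 < p <= 2 -> 0 < m -> m <= W -> `|x| <= W ->
  m `^ p + p * m `^ (p - 1) * (x - m)
    + p * (p - 1) / 2 * W `^ (p - 2) * (x - m) ^+ 2 <= `|x| `^ p.
Proof.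
move=> /[dup] p12 /andP[p1 p2] m0 mW xW.
have p0 : 0 < p by lra.
have [x0|x0] := ltP 0 x; last first.
  (* The mean value argument below stays on the positive axis, so x <= 0 is done by hand: with t =
     -x, the bounds W^(p-2) t^2 <= t^p and W^(p-2) m <= m^(p-1) absorb the three terms of the
     expanded square. *)
  move: xW; rewrite ler0_norm//; have : 0 <= - x by rewrite oppr_ge0.
  have -> : x - m = - (- x + m) by ring.
  move: (- x) => t t0 tW {x x0}.
  have := ler_sqr_powR p2 t0 tW p0.
  have := ler_sqr_powR p2 (ltW m0) mW p0.
  have -> : m `^ p = m `^ (p - 1) * m by rewrite mulrC mulr_powRB1// ltW.
  rewrite expr2 mulrA ler_pM2r//.
  have : 0 <= W `^ (p - 2) by exact: powR_ge0.
  move: (W `^ _) (m `^ _) (t `^ _) => w n s w0 wmn wts.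
  have h1 : p * (p - 1) / 2 * (w * t ^+ 2) <= 1 * s by apply: ler_pM => //; nra.
  have h2 : p * (p - 1) / 2 * (m * (w * m)) <= (p - 1) * (m * n).
    apply: ler_pM; [nra| |nra|by rewrite ler_wpM2l// ltW].
    by rewrite !mulr_ge0// ltW.
  have h3 : p * (p - 1) * (t * (w * m)) <= p * (t * n).
    apply: ler_pM; [nra| |nra|by rewrite ler_wpM2l].
    by rewrite !mulr_ge0// ltW.
  by nra.
rewrite gtr0_norm//; rewrite gtr0_norm// in xW.
set k := p * (p - 1) / 2 * W `^ (p - 2).
(* Removing the quadratic part leaves a function whose derivative is still nondecreasing on (0, W],
   hence one lying above its tangent at [m]. *)
pose g : R -> R := fun t => t `^ p - k * t ^+ 2.
pose dg (t : R) := p * t `^ (p - 1) - k * (2 * t).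
have dgP (t : R) : 0 < t -> is_derive t 1 g (dg t).
  move=> t0; have dp := is_derive1_powR p t0.
  apply: is_derive_eq; rewrite /dg /GRing.scale/= mulr1; ring.
have dg_homo (s t : R) : 0 < s -> s <= t -> t <= W -> dg s <= dg t.
  move=> s0 st tW; have := ler_powRB1 p12 s0 st tW.
  rewrite /dg /k; move: (W `^ _) (t `^ _) (s `^ _) => w t1 s1 h.
  have := ler_wpM2l (ltW p0) h; nra.
have MVTg (s t : R) : 0 < s -> s <= t ->
    exists2 c, s <= c <= t & g t - g s = dg c * (t - s).
  move=> s0 st; have [||c cst ->] := @MVT_segment R g dg s t st.
  - by move=> z /[!in_itv]/= /andP[sz _]; apply: dgP; exact: lt_trans sz.
  - apply: derivable_within_continuous => z /[!in_itv]/= /andP[sz _].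
    by have [] := dgP z (lt_le_trans s0 sz).
  - by exists c.
have : dg m * (x - m) <= g x - g m.
  have [mx|/ltW xm] := leP m x.
    have [c /andP[mc cx] ->] := MVTg _ _ m0 mx.
    rewrite ler_wpM2r ?subr_ge0//; apply: dg_homo => //; exact: le_trans xW.
  have [c /andP[xc cm] gE] := MVTg _ _ x0 xm.
  have : dg c * (m - x) <= dg m * (m - x).
    rewrite ler_wpM2r ?subr_ge0//; apply: dg_homo => //; exact: lt_le_trans xc.
  by rewrite -gE; lra.
by rewrite /g /dg/=; nra.
Qed.

End powR_inequalities.

(** * Two-point inequality for exponents between 1 and 2 *)

Section powR_two_point.
Context {R : realType}.
Implicit Types p x y W : R.

(** Add the strong tangent inequalities for x and y at their midpoint m: the linear terms cancel,
    and (x-m)^2 + (y-m)^2 = (x-y)^2 / 2. *)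
Lemma powR_two_point p x y : 1 < p <= 2 ->
  p * (p - 1) / 4 * ((`|x| + `|y|) `^ (p - 2) * (x - y) ^+ 2) <=
  2 `^ (p - 1) * (`|x| `^ p + `|y| `^ p) - `|x + y| `^ p.
Proof.
move=> /[dup] p12 /andP[p1 p2]; have p0 : 0 < p by lra.
wlog xy : x y / 0 <= x + y.
  move=> h; have [/h//|/ltW xy] := leP 0 (x + y).
  have := h (- x) (- y); rewrite !normrN -opprD normrN oppr_ge0 => /(_ xy).
  by rewrite (_ : (- x - - y) ^+ 2 = (x - y) ^+ 2)//; ring.
set W := `|x| + `|y|.
have xW : `|x| <= W by rewrite lerDl.
have yW : `|y| <= W by rewrite lerDr.
pose m := (x + y) / 2.
have tg z : `|z| <= W -> m `^ p + p * m `^ (p - 1) * (z - m)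
    + p * (p - 1) / 2 * W `^ (p - 2) * (z - m) ^+ 2 <= `|z| `^ p.
  have : 0 <= m by rewrite divr_ge0.
  (* For m = 0 the tangent vanishes, and W^(p-2) z^2 <= |z|^p suffices because p (p-1) / 2 <= 1. *)
  rewrite le_eqVlt => /predU1P[<- zW|m0 zW].
    rewrite !powR0 ?gt_eqF ?subr_gt0// mulr0 mul0r !add0r subr0.
    have := ler_sqr_powR p2 (normr_ge0 z) zW p0; rewrite real_normK ?num_real//.
    have := powR_ge0 W (p - 2); move: (W `^ _) (_ `^ p) => w n w0 h.
    rewrite -mulrA; apply: le_trans h; rewrite -[leRHS]mul1r ler_wpM2r//; last nra.
    by rewrite mulr_ge0// sqr_ge0.
  apply: powR_strong_tangent => //; rewrite ler_pdivrMr//.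
  have := ler_norm x; have := ler_norm y; have := normr_ge0 x.
  by have := normr_ge0 y; rewrite /W; lra.
(* The tangents bound |x|^p + |y|^p - 2 m^p from below by a nonnegative quantity, so the factor
   2^(p-1) >= 1 only helps. *)
have two1 : 1 <= 2 `^ (p - 1) :> R.
  by rewrite -[leLHS](powRr0 2) ler_powR ?ler1n// subr_ge0 ltW.
have -> : `|x + y| `^ p = 2 `^ (p - 1) * (2 * m `^ p).
  rewrite ger0_norm// mulrA [2 `^ _ * 2]mulrC mulr_powRB1// -powRM//.
    by congr (_ `^ _); rewrite /m; field.
  by rewrite divr_ge0.
have w0 : 0 <= W `^ (p - 2) := powR_ge0 _ _.
rewrite -mulrBr; apply: (@le_trans _ _ (`|x| `^ p + `|y| `^ p - 2 * m `^ p)).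
  have := tg _ xW; have := tg _ yW; rewrite /m.
  move: (m `^ _) => mp; move: (W `^ _) (_ `^ (p - 1)) => w mp1.
  move: (`|x| `^ p) (`|y| `^ p) => xp yp; nra.
rewrite ler_peMl//; have := tg _ xW; have := tg _ yW.
have k0 z : 0 <= p * (p - 1) / 2 * W `^ (p - 2) * (z - m) ^+ 2.
  by rewrite mulr_ge0 ?sqr_ge0// mulr_ge0// divr_ge0// mulr_ge0 ?subr_ge0 ?ltW.
have := k0 x; have := k0 y; rewrite /m.
move: (m `^ _) => mp; move: (W `^ _) (_ `^ (p - 1)) => w mp1.
move: (`|x| `^ p) (`|y| `^ p) => xp yp; nra.
Qed.

(* If |x - y| <= l W with W = |x| + |y|, the second term alone suffices; otherwise
   |x - y|^p <= l^(p-2) W^(p-2) (x - y)^2 and the first one does.  The free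
   parameter l replaces the use of Hoelder's inequality after integration. *)
Lemma powR_dist_le p x y l (S := 2 `^ (p - 1) * (`|x| `^ p + `|y| `^ p)) :
  1 < p <= 2 -> 0 < l ->
  `|x - y| `^ p <= l `^ (p - 2) * (4 / (p * (p - 1))) * (S - `|x + y| `^ p)
    + l `^ p * S.
Proof.
move=> /[dup] p12 /andP[p1 p2] l0; have p0 : 0 < p by lra.
have WS : (`|x| + `|y|) `^ p <= S by rewrite powR_mean// ltW.
have := powR_two_point x y p12; rewrite -/S.
set W := `|x| + `|y| in WS *; move=> hS.
have {}hS : W `^ (p - 2) * (x - y) ^+ 2 <= 4 / (p * (p - 1)) * (S - `|x + y| `^ p).
  by rewrite -invf_div ler_pdivlMl// divr_gt0// mulr_gt0// subr_gt0.
have l20 := powR_ge0 l (p - 2); have w20 := powR_ge0 W (p - 2).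
rewrite -mulrA; have [uW|Wu] := leP `|x - y| (l * W).
  rewrite ler_wpDl//.
    by rewrite mulr_ge0//; apply: le_trans hS; rewrite mulr_ge0// sqr_ge0.
  apply: (@le_trans _ _ (l `^ p * W `^ p)); last by rewrite ler_wpM2l// powR_ge0.
  rewrite -powRM ?addr_ge0 ?(ltW l0)// ge0_ler_powR ?nnegrE ?(ltW p0)//.
  by rewrite mulr_ge0 ?addr_ge0 ?(ltW l0).
rewrite ler_wpDr//; first by rewrite mulr_ge0 ?powR_ge0// (le_trans _ WS)// powR_ge0.
apply: (@le_trans _ _ (l `^ (p - 2) * (W `^ (p - 2) * (x - y) ^+ 2))); last first.
  by rewrite ler_wpM2l.
have W0 : 0 < W.
  rewrite lt0r addr_ge0// andbT; apply: contraTneq Wu => W0.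
  have /andP[/eqP x0 /eqP y0] : (`|x| == 0) && (`|y| == 0) by rewrite -paddr_eq0// -W0.
  move/eqP: x0; move/eqP: y0; rewrite !normr_eq0 => /eqP -> /eqP ->.
  by rewrite W0 subrr normr0 mulr0 ltxx.
have lW0 : 0 < l * W by rewrite mulr_gt0.
have u0 : 0 < `|x - y| by exact: lt_trans Wu.
rewrite mulrA -powRM ?(ltW l0) ?(ltW W0)// -[_ ^+ 2]real_normK ?num_real// -powR2//.
have -> : `|x - y| `^ p = `|x - y| `^ (p - 2) * `|x - y| `^ 2.
  by rewrite -powRD ?subrK// gt_eqF ?implybT.
rewrite ler_wpM2r ?powR_ge0//; have -> : p - 2 = - (2 - p) by ring.
rewrite !powRN lef_pV2 ?posrE ?powR_gt0// ge0_ler_powR ?nnegrE ?subr_ge0//.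
- exact: ltW.
- exact: ltW.
Qed.

End powR_two_point.

(** * Passage from p-th powers to squares *)

Section square_convexity.
Context {R : realType}.
Implicit Types p C D M S : R.

(** [M] and [D] stand for the norms of f+g and f-g, and [S] for 2^(p-1) (|f|^p + |g|^p). A good [l]
    gives D^2 <= (C+1)^(2/p) (1 - M^p/S) S^(2/p), while M^2 <= M^p S^(2/p-1) accounts for the
    remaining part of S^(2/p). *)
Lemma powR_family_sqr p C D M S : 1 < p <= 2 -> 0 <= C -> 0 <= D -> 0 <= M ->
  M `^ p <= S ->
  (forall l, 0 < l -> D `^ p <= l `^ (p - 2) * C * (S - M `^ p) + l `^ p * S) ->
  M ^+ 2 + ((C + 1) `^ (2 / p))^-1 * D ^+ 2 <= S `^ (2 / p).
Proof.
move=> /andP[p1 p2] C0 D0 M0 MS h; have p0 : 0 < p by lra.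
have C1 : 0 < C + 1 by rewrite ltr_wpDl.
have pow2p x : 0 <= x -> (x `^ p) `^ (2 / p) = x ^+ 2.
  by move=> x0; rewrite -powRrM mulrC divfK ?gt_eqF// powR2.
have S0 : 0 <= S by apply: le_trans MS; exact: powR_ge0.
move: (MS); rewrite le_eqVlt => /predU1P[MSE|].
  suff -> : D = 0 by rewrite expr0n/= mulr0 addr0 -MSE pow2p.
  have {}h l : 0 < l -> D `^ p <= l `^ p * S.
    by move=> /h; rewrite MSE subrr mulr0 add0r.
  apply/eqP/negPn/negP => Dn0.
  have Dp0 : 0 < D `^ p by rewrite powR_gt0// lt0r Dn0.
  have Sgt0 : 0 < S.
    by have := lt_le_trans Dp0 (h _ ltr01); rewrite powR1 mul1r.
  (* With this [l] the bound reads D^p <= D^p / 2, contradicting D > 0. *)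
  pose l := (D `^ p / (2 * S)) `^ p^-1.
  have l0 : 0 < l by rewrite powR_gt0// divr_gt0// mulr_gt0.
  have := h _ l0; rewrite /l -powRrM mulVf ?gt_eqF// powRr1; last first.
    by rewrite divr_ge0 ?mulr_ge0// powR_ge0.
  have -> : D `^ p / (2 * S) * S = D `^ p / 2 by field; rewrite gt_eqF.
  lra.
move=> MSlt; have Sgt0 : 0 < S by apply: le_lt_trans MSlt; exact: powR_ge0.
set d := S - M `^ p in h; have d0 : 0 < d by rewrite subr_gt0.
have dS0 : 0 < d / S by rewrite divr_gt0.
(* This l balances the two terms of [h]. *)
pose l := (d / S) `^ 2^-1; have l0 : 0 < l by exact: powR_gt0.
have l2 : l `^ 2 = d / S by rewrite -powRrM mulVf// powRr1// ltW.
have : D `^ p <= l `^ p * (S * (C + 1)).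
  apply: le_trans (h _ l0) _; rewrite le_eqVlt; apply/orP; left; apply/eqP.
  have -> : l `^ (p - 2) = l `^ p / (d / S).
    by rewrite -l2 -powRB//; apply/implyP => _; rewrite gt_eqF.
  by field; rewrite !gt_eqF.
move=> /(@ge0_ler_powR _ (2 / p)); rewrite !nnegrE powR_ge0 pow2p//.
rewrite divr_ge0 ?(ltW p0)// => /(_ isT isT).
rewrite powRM ?powR_ge0 ?mulr_ge0 ?(ltW Sgt0) ?(ltW C1)//; last exact: powR_ge0.
rewrite pow2p ?(ltW l0)// -(powR2 (ltW l0)) l2.
rewrite powRM ?(ltW Sgt0) ?(ltW C1)//.
set K := (C + 1) `^ _; set T := S `^ _; have K0 : 0 < K by exact: powR_gt0.
rewrite mulrA -ler_pdivrMr// mulrC => /(_ isT) hD.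
rewrite -lerBrDl; apply: le_trans hD _; rewrite /d.
have -> : (S - M `^ p) / S * T = T - M `^ p * (T / S) by field; rewrite gt_eqF.
rewrite lerD2l lerN2.
have -> : M ^+ 2 = M `^ p * (M `^ p) `^ (2 / p - 1).
  rewrite -powRrM (_ : p * (2 / p - 1) = 2 - p); last by field; rewrite gt_eqF.
  by rewrite -powRD subrKC ?powR2// pnatr_eq0.
rewrite ler_wpM2l ?powR_ge0//.
have -> : T / S = S `^ (2 / p - 1).
rewrite powRB ?powRr1 ?(ltW Sgt0)//; apply/implyP => _; rewrite gt_eqF//.
rewrite ge0_ler_powR ?nnegrE ?powR_ge0// subr_ge0 ler_pdivlMr// mul1r//.
Qed.

End square_convexity.

(** Taken on functions rather than classes, so that pointwise sums and differences are available; on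
    [Lfun] the norm is finite and [fine] loses nothing. *)
Definition fine_Lnorm (R : realType) d (X : measurableType d)
    (m : {measure set X -> \bar R}) (p : R) (f : X -> R) : R :=
  fine ('N[m]_p%:E[EFin \o f])%E.

(** * Norms in L^p and uniform convexity *)

Section Lp_uniform_convexity.
Context {R : realType} d (X : measurableType d) (m : {measure set X -> \bar R}).
Variable p : R.
Hypothesis p1 : 1 < p.

Local Notation N := (fine_Lnorm m p).
Implicit Types f g : X -> R.

Lemma LfunD f g : f \in Lfun m p%:E -> g \in Lfun m p%:E ->
  (fun x => f x + g x) \in Lfun m p%:E.
Proof. exact: (Lfun_addr_closed m (lt1_lee1 p1)).2. Qed.

Lemma LfunN f : f \in Lfun m p%:E -> (fun x => - f x) \in Lfun m p%:E.
Proof. exact: Lfun_oppr_closed. Qed.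

Lemma LfunB f g : f \in Lfun m p%:E -> g \in Lfun m p%:E ->
  (fun x => f x - g x) \in Lfun m p%:E.
Proof. by move=> fL gL; exact: LfunD fL (LfunN gL). Qed.

Lemma Lnorm_fin_num f : f \in Lfun m p%:E -> ('N[m]_p%:E[EFin \o f])%E \is a fin_num.
Proof.
move=> /andP[_]; rewrite inE /= => fN.
by rewrite ge0_fin_numE// Lnorm_ge0.
Qed.

Lemma fine_Lnorm_ge0 f : 0 <= N f.
Proof. exact/fine_ge0/Lnorm_ge0. Qed.

Lemma powR_fine_Lnorm f : f \in Lfun m p%:E ->
  N f `^ p = \int[m]_x (`|f x| `^ p).
Proof.
move=> fL; have p0 : p != 0 by rewrite gt_eqF// (lt_trans ltr01).
rewrite /Rintegral; under eq_integral do rewrite -poweR_EFin -abse_EFin.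
by rewrite -powR_Lnorm// -[in RHS](fineK (Lnorm_fin_num fL)).
Qed.

Lemma fine_LnormD f g : f \in Lfun m p%:E -> g \in Lfun m p%:E ->
  N (fun x => f x + g x) <= N f + N g.
Proof.
move=> fL gL; rewrite -lee_fin EFinD /fine_Lnorm !fineK ?Lnorm_fin_num ?LfunD//.
apply: minkowski_EFin; last exact: ltW.
- by move: fL => /andP[] /[!inE].
- by move: gL => /andP[] /[!inE].
Qed.

Lemma fine_LnormN f : N (fun x => - f x) = N f.
Proof. by rewrite /fine_Lnorm; congr fine; rewrite -[RHS]oppe_Lnorm. Qed.

(** The p-th powers of norms are integrals, so the pointwise inequality integrates. Free [k] and [K]
    cover both Clarkson's inequality and the family indexed by [l]. *)
Lemma powR_fine_Lnorm_le f g (k K : R) :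
  f \in Lfun m p%:E -> g \in Lfun m p%:E ->
  (forall x y : R,
    `|x - y| `^ p + k * `|x + y| `^ p <= K * (`|x| `^ p + `|y| `^ p)) ->
  N (fun x => f x - g x) `^ p + k * N (fun x => f x + g x) `^ p <=
  K * (N f `^ p + N g `^ p).
Proof.
move=> fL gL h.
have int u : u \in Lfun m p%:E -> m.-integrable setT (EFin \o (fun x => `|u x| `^ p)).
  by move=> /Lfun_integrable; apply; exact: ltW.
have fBg : (fun x => f x - g x) \in Lfun m p%:E.
  exact: LfunB.
have fDg : (fun x => f x + g x) \in Lfun m p%:E.
  exact: LfunD.
have intD (u v : X -> R) : m.-integrable setT (EFin \o u) ->
    m.-integrable setT (EFin \o v) -> m.-integrable setT (EFin \o (fun x => u x + v x)).
  by move=> iu iv; exact: (integrableD measurableT iu iv).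
have intZ (r : R) (u : X -> R) : m.-integrable setT (EFin \o u) ->
    m.-integrable setT (EFin \o (fun x => r * u x)).
  by move=> iu; exact: (integrableZl measurableT r iu).
rewrite !powR_fine_Lnorm// -RintegralZl ?int// -!RintegralD ?int ?intZ ?int//.
rewrite -RintegralZl ?intD ?int//.
by apply: le_Rintegral => //; [apply/intD/intZ|apply/intZ/intD]; exact: int.
Qed.

End Lp_uniform_convexity.

(** For p >= 2 Clarkson's inequality is integrated. For p < 2 the pointwise bound is integrated at
    each fixed [l], and [l] is chosen only afterwards, in terms of the norms. *)
Lemma Lp_uniformly_convex (R : realType) (p : R) (q := Num.max p 2) : 1 < p ->
  exists2 c : R, 0 < c & forall d (X : measurableType d)
    (m : {measure set X -> \bar R}) (f g : X -> R),
  f \in Lfun m p%:E -> g \in Lfun m p%:E ->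
  fine_Lnorm m p (fun x => f x + g x) `^ q
    + c * fine_Lnorm m p (fun x => f x - g x) `^ q <=
  2 `^ (q - 1) * (fine_Lnorm m p f `^ q + fine_Lnorm m p g `^ q).
Proof.
move=> p1; rewrite /q; have [p2|p2] := ltP p 2; last first.
  exists 1 => // d X m f g fL gL; rewrite mul1r addrC -[X in _ + X]mul1r.
  by apply: powR_fine_Lnorm_le => // x y; rewrite mul1r addrC clarkson_powR.
have p12 : 1 < p <= 2 by rewrite p1 ltW.
have p0 : 0 < p by exact: lt_trans p1.
pose C := 4 / (p * (p - 1)).
have C0 : 0 <= C by rewrite divr_ge0// mulr_ge0 ?subr_ge0 ?(ltW p0) ?(ltW p1).
exists ((C + 1) `^ (2 / p))^-1 => [|d X m f g fL gL].
  by rewrite invr_gt0 powR_gt0// ltr_wpDl.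
pose N := fine_Lnorm m p; rewrite -/N.
have N0 h : 0 <= N h by exact: fine_Lnorm_ge0.
pose S := 2 `^ (p - 1) * (N f `^ p + N g `^ p).
rewrite !powR2//; apply: (@le_trans _ _ (S `^ (2 / p))).
  apply: powR_family_sqr => //.
    apply: le_trans (powR_mean (ltW p1) (N0 f) (N0 g)).
    rewrite ge0_ler_powR ?nnegrE ?addr_ge0 ?(ltW p0)//; exact: fine_LnormD.
  move=> l l0; set k := l `^ (p - 2) * C.
  have := @powR_fine_Lnorm_le _ _ _ m p p1 f g k ((k + l `^ p) * 2 `^ (p - 1)) fL gL.
  rewrite -/N -mulrA -/S => H; rewrite -lerBrDr in H.
  apply: le_trans (H _) _; last by rewrite le_eqVlt; apply/orP; left; apply/eqP; ring.
  move=> x y; have := powR_dist_le x y p12 l0; rewrite /= -/C -/k; lra.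
(* Convexity of t^(2/p) leads from S^(2/p) back to squared norms; the powers of 2 combine to 2^(q-1)
   = 2. *)
have twop : 2 / p - 1 >= 0 by rewrite subr_ge0 ler_pdivlMr// mul1r ltW.
rewrite powRM ?powR_ge0 ?addr_ge0 ?powR_ge0// -powRrM.
apply: (@le_trans _ _ (2 `^ ((p - 1) * (2 / p)) *
    (2 `^ (2 / p - 1) * (N f ^+ 2 + N g ^+ 2)))).
  rewrite ler_wpM2l ?powR_ge0//.
  have pow2p x : 0 <= x -> (x `^ p) `^ (2 / p) = x ^+ 2.
    by move=> x0; rewrite -powRrM mulrC divfK ?gt_eqF// powR2.
  rewrite -(pow2p (N f))// -(pow2p (N g))//.
  by apply: powR_mean; rewrite ?powR_ge0// -subr_ge0.
rewrite mulrA -powRD ?pnatr_eq0 ?implybT//.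
have -> : (p - 1) * (2 / p) + (2 / p - 1) = 2 - 1 by field; rewrite gt_eqF.
by [].
Qed.

(** * Distances in L^p and the four-point inequality *)

Section four_point.
Context {R : realType} d (X : measurableType d) (m : {measure set X -> \bar R}).
Variables (p : R) (p1 : 1 < p).
Local Notation L := (LspaceType m (lt1_lee1 p1)).
Local Notation D := (@Lp_dist R d X m p%:E (lt1_lee1 p1)).
Implicit Types f g h : L.

Lemma LspaceType_Lfun f : (f : X -> R) \in Lfun m p%:E.
Proof.
apply/andP; split; rewrite inE/=.
  exact: (@measurable_funPT _ _ _ _ (repr (f : {mfun_ m, X >-> measurableTypeR R}))).
exact: Lebesgue_finite.
Qed.

Lemma Lp_distE f g : D f g = fine_Lnorm m p (fun x => f x - g x).
Proof. by []. Qed.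

Lemma Lp_dist_ge0 f g : 0 <= D f g.
Proof. exact: fine_Lnorm_ge0. Qed.

Lemma Lp_distC f g : D f g = D g f.
Proof.
rewrite !Lp_distE -fine_LnormN; congr fine_Lnorm.
by apply/funext => x; rewrite opprB.
Qed.

Lemma Lp_dist_triangle g f h : D f h <= D f g + D g h.
Proof.
have := fine_LnormD p1 (LfunB p1 (LspaceType_Lfun f) (LspaceType_Lfun g))
  (LfunB p1 (LspaceType_Lfun g) (LspaceType_Lfun h)).
rewrite !Lp_distE; congr (fine_Lnorm _ _ _ <= _).
by apply/funext => x; rewrite subrKA.
Qed.

End four_point.

(** Uniform convexity is applied to f = y - x with g_z = z - y and with g_w = w - y. The two defects
    f - g_z and f - g_w differ by z - w up to sign, so [powR_mean] recovers |z-w|^q at the cost of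
    dividing the constant by 2^(q-1). *)
Lemma Lp_four_point (R : realType) (p : R) (q := Num.max p 2) (p1 : 1 < p) :
  exists2 c : R, 0 < c & forall d (X : measurableType d)
    (m : {measure set X -> \bar R}) (x y z w : LspaceType m (lt1_lee1 p1)),
  Lp_dist x z `^ q + Lp_dist x w `^ q + c * Lp_dist z w `^ q <=
  2 `^ (q - 1) * (2 * Lp_dist x y `^ q + Lp_dist y z `^ q + Lp_dist y w `^ q).
Proof.
have [c c0 H] := Lp_uniformly_convex p1.
have q1 : 1 <= q by rewrite /q le_max (ltW p1).
have q0 : 0 <= q by exact: le_trans q1.
exists (c / 2 `^ (q - 1)) => [|d X m x y z w]; first by rewrite divr_gt0// powR_gt0.
pose N := fine_Lnorm m p.
pose f t := y t - x t; pose g u t := u t - y t : R.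
have fL : f \in Lfun m p%:E by apply: LfunB => //; exact: LspaceType_Lfun.
have gL (u : LspaceType m (lt1_lee1 p1)) : g u \in Lfun m p%:E.
  by apply: LfunB => //; exact: LspaceType_Lfun.
have main (u : LspaceType m (lt1_lee1 p1)) :
    Lp_dist x u `^ q + c * N (fun t => f t - g u t) `^ q <=
    2 `^ (q - 1) * (Lp_dist x y `^ q + Lp_dist y u `^ q).
  rewrite (Lp_distC x u) (Lp_distC x y) (Lp_distC y u) !Lp_distE.
  have := H _ _ m _ _ fL (gL u); congr (fine_Lnorm _ _ _ `^ _ + _ <= _).
  by apply/funext => t; rewrite /f /g addrC subrKA.
have := main z; have := main w.
have : Lp_dist z w `^ q <= 2 `^ (q - 1) *
    (N (fun t => f t - g z t) `^ q + N (fun t => f t - g w t) `^ q).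
  have N0 u : 0 <= N u by exact: fine_Lnorm_ge0.
  apply: le_trans (powR_mean q1 (N0 _) (N0 _)).
  rewrite ge0_ler_powR ?nnegrE ?addr_ge0 ?Lp_dist_ge0//.
  have := fine_LnormD p1 (LfunB p1 fL (gL w)) (LfunN (LfunB p1 fL (gL z))).
  rewrite fine_LnormN addrC; congr (fine_Lnorm _ _ _ <= _).
  by apply/funext => t; rewrite /f /g; ring.
set a := 2 `^ (q - 1); have a0 : 0 < a by exact: powR_gt0.
move=> h1 h2 h3.
have : c / a * Lp_dist z w `^ q <= c *
  (N (fun t => f t - g z t) `^ q + N (fun t => f t - g w t) `^ q).
  rewrite -mulrA ler_wpM2l ?(ltW c0)// mulrC ler_pdivrMr// mulrC//.
lra.
Qed.

(** * Averages over words of fixed length *)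

Section word_average.
Context {R : realType}.
Implicit Types (g h : seq bool -> R) (n : nat).

(** Recursion on the first letter makes an average below a vertex split over its two subtrees by
    computation. *)
Fixpoint word_avg n g : R :=
  if n is n'.+1 then
    (word_avg n' (fun t => g (true :: t)) + word_avg n' (fun t => g (false :: t))) / 2
  else g [::].

Lemma le_word_avg n g h : (forall t, size t = n -> g t <= h t) ->
  word_avg n g <= word_avg n h.
Proof.
elim: n g h => [|n IH] g h gh /=; first exact: gh.
by rewrite ler_pM2r ?invr_gt0// lerD// IH// => t tn; apply: gh; rewrite /= tn.
Qed.

Lemma word_avg_affine n (a b c : R) g h :
  word_avg n (fun t => a * g t + b * h t + c) =
  a * word_avg n g + b * word_avg n h + c.
Proof. by elim: n g h => [|n IH] g h //=; rewrite !IH; field. Qed.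

Lemma word_avg_ge0 n g : (forall t, 0 <= g t) -> 0 <= word_avg n g.
Proof.
elim: n g => [|n IH] g g0 /=; first exact: g0.
by rewrite divr_ge0// addr_ge0// IH.
Qed.

Lemma word_avg_cat k n g :
  word_avg (k + n) g = word_avg k (fun u => word_avg n (fun v => g (u ++ v))).
Proof. by elim: k g => [|k IH] g //=; rewrite !IH. Qed.

End word_average.

(** * Recursion over dyadic scales in the tree *)

Section tree_recursion.
Context {R : realType}.
Variables (D : seq bool -> seq bool -> R) (q c : R) (N : nat) (r : nat -> R).
Hypotheses (q0 : 0 < q) (c0 : 0 < c) (D0 : forall s t, 0 <= D s t)
  (r0 : forall k, 0 <= r k).
Hypothesis D_edge : forall s b, (size s < N)%N -> D s (rcons s b) <= 1.
Hypothesis D_four : forall x y z w,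
  D x z `^ q + D x w `^ q + c * D z w `^ q <=
  2 `^ (q - 1) * (2 * D x y `^ q + D y z `^ q + D y w `^ q).
Hypothesis r_le : forall k s t t', (size t).+1 = (2 ^ k)%N -> size t' = size t ->
  (size s + 2 ^ k <= N)%N -> r k <= D (s ++ true :: t) (s ++ false :: t').

(** Normalises the gain at step k: c/2 r_k^q is c' times (2^(k+1))^q (r_k/2^k)^q. *)
Let c' := c / (2 * 2 `^ q).

(** The vertex [s] is arbitrary because the induction hypothesis serves twice: at [s] for the first
    half [u] of the word, and at [s ++ u] for the second half. *)
Lemma word_avg_powR_le k s : (size s + 2 ^ k <= N)%N ->
  word_avg (2 ^ k) (fun t => D s (s ++ t) `^ q) <=
  ((2 ^ k)%:R `^ q) * (1 - c' * \sum_(j < k) (r j / (2 ^ j)%:R) `^ q).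
Proof.
have pow2q : 2 `^ q = 2 * 2 `^ (q - 1) :> R by rewrite mulr_powRB1.
have a0 : 0 < 2 `^ (q - 1) :> R by exact: powR_gt0.
elim: k s => [|k IH] s sN.
  rewrite big_ord0 mulr0 subr0 mulr1 powR1 /= !cats1.
  have le1 b : D s (rcons s b) `^ q <= 1.
    apply: (@le_trans _ _ (1 `^ q)); last by rewrite powR1.
    by rewrite ge0_ler_powR ?nnegrE ?(ltW q0)//; apply: D_edge; rewrite -addn1.
  by have := le1 true; have := le1 false; lra.
set E := (2 ^ k)%:R `^ q * (1 - c' * \sum_(j < k) (r j / (2 ^ j)%:R) `^ q) in IH.
have -> : (2 ^ k.+1)%:R `^ q * (1 - c' * \sum_(j < k.+1) (r j / (2 ^ j)%:R) `^ q)
    = 2 `^ (q - 1) * E + 2 `^ (q - 1) * E - c / 2 * r k `^ q.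
  have k0 : 0 < (2 ^ k)%:R `^ q :> R by rewrite powR_gt0// ltr0n expn_gt0.
  have -> : r k `^ q = (2 ^ k)%:R `^ q * (r k / (2 ^ k)%:R) `^ q.
    by rewrite -powRM ?divr_ge0// mulrC divfK.
  rewrite big_ord_recr/= expnS natrM powRM// pow2q /E /c' pow2q.
  by field; rewrite gt_eqF.
rewrite expnS mul2n -addnn word_avg_cat in sN *.
have n1 : (2 ^ k = (2 ^ k).-1.+1)%N by rewrite prednK// expn_gt0.
have sN1 : (size s + 2 ^ k <= N)%N.
  by apply: leq_trans sN; rewrite leq_add2l leq_addr.
pose g u := D s (s ++ u) `^ q.
(* The zero summand gives the bound the shape required by [word_avg_affine]. *)
have step u : size u = (2 ^ k)%N ->
    word_avg (2 ^ k) (fun v => D s (s ++ u ++ v) `^ q) <=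
    2 `^ (q - 1) * g u + 0 * g u + (2 `^ (q - 1) * E - c / 2 * r k `^ q).
  move=> su; set y := s ++ u.
  have yN : (size y + 2 ^ k <= N)%N.
    by move: sN; rewrite /y size_cat su addnA.
  have -> : (fun v => D s (s ++ u ++ v) `^ q) = (fun v => D s (y ++ v) `^ q).
    by apply/funext => v; rewrite catA.
  have := IH y yN; rewrite n1 /= => IHy.
  set n := (2 ^ k).-1 in n1 IHy *.
  pose P b v := D y (y ++ b :: v) `^ q.
  pose Q b v := D s (y ++ b :: v) `^ q.
  (* The four-point inequality is averaged over [v], with the same [v] placed below both
     branches. *)
  have := @le_word_avg _ n (fun v => 1 * Q true v + 1 * Q false v + 0)
    (fun v => 2 `^ (q - 1) * P true v + 2 `^ (q - 1) * P false v
      + (2 `^ (q - 1) * (2 * g u) - c * r k `^ q)).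
  rewrite !word_avg_affine => H.
  have {}H : word_avg n (Q true) + word_avg n (Q false) <=
    2 `^ (q - 1) * (word_avg n (P true) + word_avg n (P false))
      + (2 `^ (q - 1) * (2 * g u) - c * r k `^ q).
    rewrite mulrDr; move: H; rewrite !mul1r addr0; apply => v vn.
    have := D_four s y (y ++ true :: v) (y ++ false :: v).
    have : c * r k `^ q <= c * D (y ++ true :: v) (y ++ false :: v) `^ q.
      rewrite ler_wpM2l ?(ltW c0)// ge0_ler_powR ?nnegrE ?(ltW q0)//.
      by rewrite r_le// vn -n1.
    rewrite !mul1r /Q /P /g -/y; lra.
  move: H; rewrite /P /Q mul0r addr0.
  have := ler_wpM2l (ltW a0) IHy; lra.
apply: le_trans (le_word_avg step) _; rewrite word_avg_affine mul0r addr0.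
by rewrite addrA lerD2r lerD2r ler_wpM2l ?(ltW a0)// IH.
Qed.

(** At the root the average is nonnegative, so its upper bound in [word_avg_powR_le] cannot be
    negative. *)
Lemma sum_scales_le k : (2 ^ k <= N)%N ->
  \sum_(j < k) (r j / (2 ^ j)%:R) `^ q <= 2 * 2 `^ q / c.
Proof.
move=> kN; have := @word_avg_powR_le k [::] kN.
have c'0 : 0 < c' by rewrite divr_gt0// mulr_gt0// powR_gt0.
have := @word_avg_ge0 R (2 ^ k) (fun t => D [::] t `^ q) (fun t => powR_ge0 _ _).
move=> /le_trans /[apply]; rewrite pmulr_rge0; last first.
  by rewrite powR_gt0// ltr0n expn_gt0.
by rewrite subr_ge0 -ler_pdivlMl// mulr1 /c' invf_div.
Qed.

End tree_recursion.

(** * Bounds on the tree distance *)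

Section tree_distance.
Context {R : realType}.

(** Telescoping along a shortest walk; lower bounds on distances then come from a suitable [phi]. *)
Lemma tree_dist_ge (phi : seq bool -> R) N (u v : tree N) :
  (forall s b, `|phi (rcons s b) - phi s| <= 1) ->
  `|phi v - phi u| <= (tree_dist u v)%:R.
Proof.
move=> phi1; rewrite /tree_dist; case: ex_minnP => n /existsP[w /andP[uw /eqP <-]] _.
rewrite -[X in X%:R](size_tuple w); move: (tval w) uw => {n v}{}w.
elim: w u => [|x w IH] u /=; first by rewrite subrr normr0.
move=> /andP[/existsP[b ux] /IH {}IH].
rewrite -(subrKA (phi x)) -natr1 (le_trans (ler_normD _ _))// lerD//.
by case/orP: ux => /eqP ->; rewrite // distrC.
Qed.

Lemma tree_dist_edge N (u v : tree N) (b : bool) :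
  v = rcons u b :> seq bool -> (tree_dist u v <= 1)%N.
Proof.
move=> vE; rewrite /tree_dist; case: ex_minnP => n _; apply.
apply/existsP; exists [tuple v]; rewrite /= eqxx !andbT.
by apply/existsP; exists b; rewrite vE eqxx.
Qed.

(* Height of x above s, counted positively on one of the two branches at s and
   negatively on the other; it is 1-Lipschitz. *)
Let branch_height (s x : seq bool) : R :=
  if prefix s x then (-1) ^+ nth false x (size s) * ((size x)%:R - (size s)%:R)
  else 0.

Let branch_height_rcons s x b :
  `|branch_height s (rcons x b) - branch_height s x| <= 1.
Proof.
rewrite /branch_height size_rcons; have [/prefixP[y ->]|nsx] := boolP (prefix s x).
  rewrite rcons_cat prefix_prefix !nth_cat ltnn subnn size_cat -natr1 natrD.
  (* At [s] itself the sign is read from the default of [nth], but it multiplies 0. *)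
  case: y => [|a y] /=.
    rewrite addr0 subrr mulr0 subr0 normrM normrX normrN1 expr1n mul1r.
    by rewrite addrAC subrr add0r normr1.
  rewrite -mulrBr normrM normrX normrN1 expr1n mul1r.
  by rewrite (_ : _ - _ = 1) ?normr1//; ring.
(* If [s] becomes a prefix only after appending [b], it is the whole new word, whose height is 0. *)
case: ifP => [|_]; last by rewrite subrr normr0.
move=> /prefixP[y]; case/lastP: y => [|y a] xE.
  by rewrite -(size_rcons x b) xE cats0 subrr mulr0 subrr normr0.
move: xE nsx; rewrite -rcons_cat => /rcons_inj[-> _].
by rewrite prefix_prefix.
Qed.

(** The branch heights of the two vertices above [s] are n+1 with opposite signs. *)
Lemma tree_dist_branch N (u v : tree N) s t t' n :
  u = s ++ true :: t :> seq bool -> v = s ++ false :: t' :> seq bool ->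
  size t = n -> size t' = n -> (n.+1 * 2)%:R <= (tree_dist u v)%:R :> R.
Proof.
move=> uE vE tn t'n; have := tree_dist_ge u v (branch_height_rcons s).
apply: le_trans; rewrite uE vE /branch_height !prefix_prefix.
rewrite !nth_cat !ltnn !subnn /= !size_cat /= tn t'n !natrD !natrM.
have -> : (-1) ^+ false * ((size s)%:R + n.+1%:R - (size s)%:R) -
  (-1) ^+ true * ((size s)%:R + n.+1%:R - (size s)%:R) = n.+1%:R * 2 :> R.
  by rewrite expr0 expr1; ring.
by rewrite ger0_norm// mulr_ge0.
Qed.

End tree_distance.

(** * Integration over dyadic intervals *)

Section dyadic_integral.
Context {R : realType}.
Local Notation mu := (@lebesgue_measure R).

Import HBNNSimple.

(** The integral of a nonnegative function is a supremum over simple functions below it. This form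
    applies to the compression without a study of its measurability. *)
Lemma ge0_le_integral_nonmeasurable d (X : measurableType d)
    (m : {measure set X -> \bar R}) (A : set X) (f g : X -> \bar R) :
  (forall x, A x -> (0 <= f x)%E) -> (forall x, A x -> (f x <= g x)%E) ->
  (\int[m]_(x in A) f x <= \int[m]_(x in A) g x)%E.
Proof.
move=> f0 fg; have g0 x : A x -> (0 <= g x)%E.
  by move=> Ax; exact: le_trans (f0 x Ax) (fg x Ax).
rewrite !ge0_integralE//; apply: ereal_sup_le => _ [h /= hf <-]; exists h => //= x.
apply: le_trans (hf x) _; rewrite /patch; case: ifPn => // /set_mem; exact: fg.
Qed.

Lemma dyadic_scale (K : nat) (t : R) : 1 <= t -> t <= (2 ^ K.+1)%:R ->
  exists2 k, (k < K.+1)%N & (2 ^ k)%:R <= t <= (2 ^ k.+1)%:R.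
Proof.
move=> t1; elim: K => [|K IH] tK; first by exists 0%N => //; rewrite t1.
have [/IH[k kK tk]|/ltW tK'] := leP t (2 ^ K.+1)%:R.
  by exists k => //; exact: leqW.
by exists K.+1 => //; rewrite tK'.
Qed.

(** [h] lies below a step function, and the length 2^k of each interval cancels the denominator. The
    closed intervals overlap at endpoints, which is harmless for an upper bound. *)
Lemma dyadic_integral_le (h : R -> R) (a : nat -> R) (K : nat) (T : R) :
  T <= (2 ^ K.+1)%:R -> (forall t, 1 <= t -> 0 <= h t) ->
  (forall k t, (k < K.+1)%N -> (2 ^ k)%:R <= t <= (2 ^ k.+1)%:R -> t <= T ->
    h t <= a k / (2 ^ k)%:R) -> (forall k, 0 <= a k) ->
  (\int[mu]_(t in `[1%R, T]) (h t)%:E <= (\sum_(k < K.+1) a k)%:E)%E.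
Proof.
move=> TK h0 ha a0.
pose I k : set (measurableTypeR R) := `[(2 ^ k)%:R, (2 ^ k.+1)%:R]%classic.
pose s k : measurableTypeR R -> R := fun t => a k / (2 ^ k)%:R * \1_(I k) t.
have ak0 k : 0 <= a k / (2 ^ k)%:R by rewrite divr_ge0.
have s0 k t : (0 <= (s k t)%:E)%E by rewrite lee_fin mulr_ge0.
have mI k : measurable (I k) by exact: measurable_itv.
have ms k : measurable_fun setT (s k).
  by apply: measurable_funM => //; exact: measurable_indic.
have intI k : (\int[mu]_t (s k t)%:E = (a k)%:E)%E.
  under eq_integral do rewrite EFinM.
  rewrite ge0_integralZl_EFin//; last exact/measurable_EFinP/measurable_indic.
  rewrite integral_indic// setIT.
  have := @lebesgue_measure_itv R `[(2 ^ k)%:R, (2 ^ k.+1)%:R].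
  rewrite -/(I k) /= lte_fin ltr_nat ltn_exp2l// ltnSn => ->.
  rewrite -EFinB -EFinM expnS natrM; congr EFin.
  by field; rewrite pnatr_eq0 expn_eq0.
apply: (@le_trans _ _ (\int[mu]_t \sum_(k < K.+1) (s k t)%:E)%E); last first.
  rewrite ge0_integral_sum//; last by move=> k; exact/measurable_EFinP.
  by rewrite -sumEFin; apply: lee_sum => k _; rewrite -intI.
rewrite integral_mkcond; apply: ge0_le_integral_nonmeasurable => t _.
  rewrite /patch; case: ifPn => // /set_mem/=.
  by rewrite in_itv/= => /andP[t1 _]; rewrite lee_fin h0.
rewrite /patch; case: ifPn => [/set_mem/=|_]; last exact: sume_ge0.
rewrite in_itv/= => /andP[t1 tT].
have [k kK tk] := dyadic_scale t1 (le_trans tT TK).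
rewrite (bigD1 (Ordinal kK))//= -[X in (X <= _)%E]adde0 leeD//; last first.
  exact: sume_ge0.
by rewrite /s /indic mem_set//= mulr1 lee_fin ha.
Qed.

End dyadic_integral.

(** * Sign and monotonicity of the compression *)

Section compression_theory.
Context {R : realType} (X Y : Type) (dX : X -> X -> R) (dY : Y -> Y -> R)
  (F : X -> Y).
Hypothesis dY0 : forall u v, 0 <= dY u v.
Local Notation rho := (compression dX dY F).

Lemma compression_le t u v : t <= dX u v -> rho t <= dY (F u) (F v).
Proof.
move=> tuv; apply: ge_inf; last by exists (u, v).
by exists 0 => _ [xy _ <-].
Qed.

Lemma compression_ge0 t : 0 <= rho t.
Proof.
rewrite /compression; set A := (X in inf X).
have [->|/set0P A0] := eqVneq A set0; first by rewrite inf0.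
by apply: lb_le_inf => // _ [xy _ <-].
Qed.

(** The pair [u], [v] keeps the set defining [rho t] nonempty; otherwise [rho t] would be the junk
    value 0. *)
Lemma compression_homo s t u v : s <= t -> t <= dX u v -> rho s <= rho t.
Proof.
move=> st tuv; apply: lb_le_inf; first by exists (dY (F u) (F v)), (u, v).
by move=> _ [[x y] /= txy <-]; apply: compression_le; exact: le_trans txy.
Qed.

End compression_theory.

(** * Integral bound for maps from trees to L^p *)

Theorem theorem4 (R : realType) (p : R) (p1 : 1 < p) :
  let q := Num.max p 2 in
  exists C : R, forall N : nat, (1 <= N)%N ->
    forall (d : measure_display) (X : measurableType d)
      (m : {measure set X -> \bar R}) (F : tree N -> LspaceType m (lt1_lee1 p1)),
    (forall u v : tree N, Lp_dist (F u) (F v) <= (tree_dist u v)%:R) ->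
    let rho := compression (fun u v : tree N => (tree_dist u v)%:R)
                 (@Lp_dist R d X m p%:E (lt1_lee1 p1)) F in
    (\int[lebesgue_measure]_(t in `[1%R, (2 * N)%:R]) ((rho t / t) `^ q / t)%:E
      <= C%:E)%E.
Proof.
move=> q; have [c c0 four] := Lp_four_point p1.
have q0 : 0 < q by rewrite lt_max (lt_trans ltr01 p1).
(* The first summand bounds the scales k < K; each 4^q bounds one of the two last dyadic
   intervals. *)
exists (2 * 2 `^ q / c + (4 `^ q + 4 `^ q)) => N N1 d X m F lipF /=.
set rho := compression _ _ _.
(* Words longer than [N] go to a default vertex, so [D] is total; the four-point inequality survives
   because it holds for arbitrary points. *)
pose T s : tree N := insub_bseq N s.
have valT s : (size s <= N)%N -> T s = s :> seq bool.
  by move=> sN; rewrite /T /insub_bseq val_insubd sN.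
pose D s t := Lp_dist (F (T s)) (F (T t)).
have D0 s t : 0 <= D s t by exact: Lp_dist_ge0.
have D_edge s b : (size s < N)%N -> D s (rcons s b) <= 1.
  move=> sN; apply: le_trans (lipF _ _) _; rewrite lern1.
  by apply: (@tree_dist_edge N _ _ b); rewrite !valT ?size_rcons// ltnW.
have rho0 t : 0 <= rho t by apply: compression_ge0; exact: Lp_dist_ge0.
have branch s t t' n : size t = n -> size t' = n -> (size s + n.+1 <= N)%N ->
    (n.+1 * 2)%:R <= (tree_dist (T (s ++ true :: t)) (T (s ++ false :: t')))%:R :> R.
  move=> tn t'n sN; apply: (@tree_dist_branch R N _ _ s t t') => //.
    by rewrite valT// size_cat /= tn.
  by rewrite valT// size_cat /= t'n.
pose K := trunc_log 2 N.
have KN : (2 ^ K <= N)%N by exact: trunc_logP.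
have NK : (N < 2 ^ K.+1)%N by exact: trunc_log_ltn.
(* Two branches of length 2^k leaving a common vertex end at distance 2^(k+1). *)
pose r k := rho (2 ^ k.+1)%:R.
have scales : \sum_(j < K) (r j / (2 ^ j)%:R) `^ q <= 2 * 2 `^ q / c.
  apply: (@sum_scales_le R D q c N r) => //.
  - by move=> k; exact: rho0.
  - by move=> x y z w; exact: four.
  - move=> k s t t' tk t't sN; apply: compression_le; first exact: Lp_dist_ge0.
    have := @branch s t t' (size t) erefl t't; rewrite tk => /(_ sN).
    by rewrite expnS mulnC.
have D_root s b : (size s < N)%N -> D [::] (rcons s b) <= (size s).+1%:R.
  elim/last_ind: s b => [|s b' IH] b sN; first by apply: le_trans (D_edge _ _ _) _.
  apply: le_trans (Lp_dist_triangle (F (T (rcons s b'))) _ _) _.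
  rewrite -natr1 lerD ?D_edge// size_rcons IH//.
  by apply: ltnW; rewrite -(size_rcons s b').
(* Tested on the two constant words of length [N]: they are 2N apart, and their images are joined
   through the image of the root. *)
have rho_le t : t <= (2 * N)%:R -> rho t <= (2 * N)%:R.
  move=> tN; pose w (b : bool) := b :: nseq N.-1 b.
  have D_w b : D [::] (w b) <= N%:R.
    rewrite /w lastI; apply: le_trans (D_root _ _ _) _;
      by rewrite size_belast size_nseq prednK.
  apply: (@le_trans _ _ (D (w true) (w false))).
    apply: compression_le; first exact: Lp_dist_ge0.
    apply: le_trans tN _; rewrite -[in X in X <= _](prednK N1) mulnC.
    by apply: (branch [::]); rewrite ?size_nseq//= add0n prednK.
  apply: le_trans (Lp_dist_triangle (F (T [::])) _ _) _.
  by rewrite Lp_distC mul2n -addnn natrD; apply: lerD; exact: D_w.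
pose a k := if (k < K)%N then (r k / (2 ^ k)%:R) `^ q else 4 `^ q.
(* Since N < 2^(K+1), the scales k <= K+1 reach up to 2N. *)
apply: (@le_trans _ _ (\sum_(k < K.+2) a k)%:E); last first.
  rewrite lee_fin !big_ord_recr /= /a ltnn ltnNge leqnSn /= -addrA lerD2r.
  by apply: le_trans scales; apply: ler_sum => k _; rewrite ltn_ord.
apply: dyadic_integral_le => [|t t1|k t kK /andP[kt tk] tN|k].
- by rewrite ler_nat expnS leq_mul2l ltnW.
- have t0 : 0 < t by exact: lt_le_trans t1.
  by rewrite divr_ge0 ?powR_ge0// ltW.
- have k0 : 0 < (2 ^ k)%:R :> R by rewrite ltr0n expn_gt0.
  have t0 : 0 < t by exact: lt_le_trans kt.
  have inv_le : t^-1 <= (2 ^ k)%:R^-1 by rewrite lef_pV2.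
  have rt0 : 0 <= rho t / t by rewrite divr_ge0// ltW.
  apply: ler_pM; rewrite ?powR_ge0 ?invr_ge0 ?(ltW t0)// /a.
  case: ifPn => kltK.
    have rk0 : 0 <= r k by exact: rho0.
    rewrite ge0_ler_powR ?nnegrE ?(ltW q0)//; first by rewrite divr_ge0.
    apply: ler_pM; rewrite ?invr_ge0 ?(ltW t0)//.
    (* Supplies a pair at distance at least 2^(k+1), as [compression_homo] requires. *)
    have := @branch [::] (nseq (2 ^ k).-1 true) (nseq (2 ^ k).-1 true) (2 ^ k).-1.
    rewrite !size_nseq prednK ?expn_gt0// => /(_ erefl erefl).
    have kN : (0 + 2 ^ k <= N)%N by apply: leq_trans KN; rewrite leq_exp2l// ltnW.
    move=> /(_ kN) H; apply: compression_homo tk _; first exact: Lp_dist_ge0.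
    by rewrite expnS mulnC; exact: H.
  (* For k >= K: rho(t) <= 2N <= 4 2^K <= 4 2^k <= 4t, whence the constant 4. *)
  rewrite ge0_ler_powR ?nnegrE ?(ltW q0)//.
  rewrite ler_pdivrMr//; apply: le_trans (rho_le _ tN) _.
  apply: (@le_trans _ _ (4 * (2 ^ k)%:R)); last by rewrite ler_wpM2l.
  rewrite -natrM ler_nat (@leq_trans (2 * 2 ^ K.+1))//.
    by rewrite leq_mul2l ltnW.
  by rewrite expnS mulnA leq_mul2l leq_exp2l// leqNgt.
- by rewrite /a; case: ifP => _; exact: powR_ge0.
Qed.
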